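(* Let $u,v,w$ be weights on $(0,\infty)$. Assume that $u$ is such that $U$ is admissible. Let $$\varphi(t):=\operatorname*{ess\,sup}_{s\in(0,t)}U(s)\operatorname*{ess\,sup}_{\tau\in(s,\infty)}\frac{w(\tau)}{U(\tau)},\qquad t\in(0,\infty),$$ be non-degenerate with respect to $U$. Consider the inequality $$\|Sh\|_{\infty,w,(0,\infty)}\le c\,\|h\|_{p,v,(0,\infty)},\qquad( * )$$ where $c$ is a finite constant independent of $h$. (i) Let $p=1$. Then $( * )$ holds for every $h\in\mathcal M^+(0,\infty)$ if and only if $$S_6:=\sup_{x\in(0,\infty)}\left(\operatorname*{ess\,sup}_{s\in(0,\infty)}w(s)\,\mathcal U(x,s)\right)U(x)^{-1}\sup_{t\in(0,x)}U(t)\operatorname*{ess\,sup}_{s\in(t,\infty)}(U(s)v(s))^{-1}<\infty .$$ Moreover, the best constant $c$ in $( * )$ satisfies $c\approx S_6$. (ii) Let $1<p<\infty$. Then $( * )$ holds for every $h\in\mathcal M^+(0,\infty)$ if and only if $$S_7:=\sup_{x\in(0,\infty)}\left(\operatorname*{ess\,sup}_{s\in(0,\infty)}w(s)\,\mathcal U(x,s)\right)\left(\int_0^\infty\mathcal U(t,x)^{p'}U(t)^{-p'}v(t)^{1-p'}\,dt\right)^{\frac1{p'}}<\infty .$$ Moreover, the best constant $c$ in $( * )$ satisfies $c\approx S_7$. (iii) Let $p=\infty$. Then $( * )$ holds for every $h\in\mathcal M^+(0,\infty)$ if and only if $$S_8:=\sup_{x\in(0,\infty)}\left(\operatorname*{ess\,sup}_{s\in(0,\infty)}w(s)\,\mathcal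 U(x,s)\right)\left(\int_0^\infty\mathcal U(t,x)U(t)^{-1}\frac{dt}{v(t)}\right)<\infty .$$ Moreover, the best constant $c$ in $( * )$ satisfies $c\approx S_8$.
   Context: A weight is a locally integrable non-negative function on $(0,\infty)$; $\mathcal M^+(0,\infty)$ is the set of non-negative measurable functions on $(0,\infty)$. $U(t)=\int_0^tu(s)\,ds$, with $U(t)>0$ for all $t>0$, and $\mathcal U(x,t)=\dfrac{U(x)}{U(t)+U(x)}$. $U$ is admissible if it is continuous and strictly increasing on $[0,\infty)$, $U(0)=0$ and $\lim_{t\to\infty}U(t)=\infty$. A function $\varphi$ is non-degenerate with respect to $U$ if $$\lim_{t\to0+}\varphi(t)=\lim_{t\to\infty}\frac1{\varphi(t)}=\lim_{t\to\infty}\frac{\varphi(t)}{U(t)}=\lim_{t\to0+}\frac{U(t)}{\varphi(t)}=0 .$$ $\|f\|_{p,v,(0,\infty)}=\left(\int_0^\infty|f(x)|^pv(x)\,dx\right)^{1/p}$ for $0<p<\infty$ and $\|f\|_{\infty,w,(0,\infty)}=\operatorname{ess\,sup}_{x\in(0,\infty)}|f(x)|w(x)$. The generalized Stieltjes transform is $(Sh)(x)=\int_0^\infty\frac{h(t)\,dt}{U(x)+U(t)}$. $p'$ is defined by $1/p+1/p'=1$. Conventions: $1/0=\infty$, $1/\infty=0$, $0\cdot\infty=0$, $0/0=0$, $\infty/\infty=0$. $a\approx b$ means $\lambda^{-1}a\le b\le\lambda a$ with $\lambda>0$ depending only on inessential parameters (here $p$). *)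

(* Defs.v *)
From HB Require Import structures.
From mathcomp Require Import all_boot all_order all_algebra.
From mathcomp Require Import all_classical all_reals all_analysis.
From mathcomp Require Import measurable_realfun ess_sup_inf.

Set Implicit Arguments.
Unset Strict Implicit.
Unset Printing Implicit Defensive.

Import Order.TTheory GRing.Theory Num.Theory.
Import numFieldNormedType.Exports.

Local Open Scope classical_set_scope.
Local Open Scope ring_scope.
Local Open Scope ereal_scope.

(* Functions on (0,oo) are represented by functions on R; only their values on
   `]0, +oo[ are used.  Products and inverses are those of [\bar R], which
   satisfy 1/0 = oo, 1/oo = 0, 0 * oo = 0, 0/0 = 0 and oo/oo = 0. *)

Section Defs.
Context {R : realType}.
Implicit Types (u v w : R -> R) (U : R -> R) (f h phi : R -> \bar R).

Definition weight v : Prop :=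
  locally_integrable `]0%R, +oo[ v /\ forall x : R, (0 < x -> 0 <= v x)%R.

Definition Mplus h : Prop :=
  measurable_fun (`]0%R, +oo[ : set R) h /\ forall x : R, (0 < x)%R -> 0 <= h x.

Definition esssup (i : interval R) f : \bar R :=
  ess_sup (mrestr (@lebesgue_measure R) (measurable_itv i)) f.

(* [poweR] sends 0 to 0 for a negative exponent; here 0 ^ r = 1/0 = oo. *)
Definition epow (x : \bar R) (r : R) : \bar R :=
  if (r < 0)%R then (x `^ (- r))^-1 else x `^ r.

(* If [u] is not integrable near 0, [Rintegral] is 0 for every t; this case is
   excluded by [admissible]. *)
Definition primitive u (t : R) : R :=
  Rintegral (@lebesgue_measure R) `]0%R, t] u.

Definition admissible U : Prop :=
  [/\ {within `[0%R, +oo[, continuous U},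
      {in `[0%R, +oo[ &, {homo U : x y / (x < y)%R}},
      U 0%R = 0%R &
      U t @[t --> +oo%R] --> +oo%R].

Definition nondegenerate_wrt phi U : Prop :=
  [/\ phi t @[t --> 0%R^'+] --> (0 : \bar R),
      (phi t)^-1 @[t --> +oo%R] --> (0 : \bar R),
      phi t / (U t)%:E @[t --> +oo%R] --> (0 : \bar R) &
      (U t)%:E / phi t @[t --> 0%R^'+] --> (0 : \bar R)].

Definition calU U (x t : R) : R := (U x / (U t + U x))%R.

(* Only 0 < p <= oo is meaningful. *)
Definition wnorm (p : \bar R) v f : \bar R :=
  match p with
  | r%:E => (\int[lebesgue_measure]_(x in `]0%R, +oo[)
              (`|f x| `^ r * (v x)%:E)) `^ r^-1
  | +oo => esssup `]0%R, +oo[ (fun x => `|f x| * (v x)%:E)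
  | -oo => 0
  end.

Definition stieltjes u h (x : R) : \bar R :=
  \int[lebesgue_measure]_(t in `]0%R, +oo[)
    (h t / (primitive u x + primitive u t)%:E).

Definition phi_of u w (t : R) : \bar R :=
  esssup `]0%R, t[ (fun s =>
    (primitive u s)%:E *
    esssup `]s, +oo[ (fun tau => (w tau)%:E / (primitive u tau)%:E)).

Definition standing_assumptions u v w : Prop :=
  [/\ weight u, weight v, weight w, admissible (primitive u) &
      nondegenerate_wrt (phi_of u w) (primitive u)].

Definition stieltjes_ineq u v w (p : \bar R) (c : R) : Prop :=
  forall h, Mplus h -> wnorm +oo w (stieltjes u h) <= c%:E * wnorm p v h.

Definition best_constant u v w (p : \bar R) : \bar R :=
  ereal_inf [set c%:E | c in [set c : R | (0 <= c)%R /\ stieltjes_ineq u v w p c]].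

Definition sup_w_calU u w (x : R) : \bar R :=
  esssup `]0%R, +oo[ (fun s => (w s)%:E * (calU (primitive u) x s)%:E).

Definition S6 u v w : \bar R :=
  ereal_sup [set sup_w_calU u w x * (primitive u x)%:E^-1 *
      ereal_sup [set (primitive u t)%:E *
          esssup `]t, +oo[ (fun s => ((primitive u s)%:E * (v s)%:E)^-1)
        | t in `]0%R, x[]
    | x in `]0%R, +oo[].

(* [q] stands for the exponent p'. *)
Definition S7 u v w (q : R) : \bar R :=
  ereal_sup [set sup_w_calU u w x *
      epow (\int[lebesgue_measure]_(t in `]0%R, +oo[)
              (epow (calU (primitive u) t x)%:E q *
               epow (primitive u t)%:E (- q) * epow (v t)%:E (1 - q)))
           q^-1
    | x in `]0%R, +oo[].

Definition S8 u v w : \bar R :=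
  ereal_sup [set sup_w_calU u w x *
      \int[lebesgue_measure]_(t in `]0%R, +oo[)
        ((calU (primitive u) t x)%:E * (primitive u t)%:E^-1 * (v t)%:E^-1)
    | x in `]0%R, +oo[].

Definition equiv_upto (lambda : R) (a b : \bar R) : Prop :=
  (lambda^-1)%:E * a <= b /\ b <= lambda%:E * a.

End Defs.

(* Main.v *)
(* Write k_x(t) = 1 / (U x + U t), so that Sh x = int h k_x, let N x be the norm
   of k_x in the dual of the weighted L^p space and
   W x = ess sup_s w s * U x / (U x + U s).  The elementary inequality
   U x / (U x + U s) * k_x <= k_s gives W x * Sh x <= ||Sh||_{oo,w} for every x.
   Conversely, if x < s and U x >= U s / 2 then w s <= 3 w s U x / (U x + U s) and
   Sh s <= Sh x; letting x range over the rationals, ||Sh||_{oo,w} <= 3 sup_x W x * Sh x.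
   Hence the best constant is comparable to sup_x W x * N x, which is S_7 and S_8
   exactly, and S_6 up to a factor 2 since max <= U x + U t <= 2 max. *)
Require Import Defs.
From HB Require Import structures.
From mathcomp Require Import all_boot all_order all_algebra.
From mathcomp Require Import all_classical all_reals all_analysis.
From mathcomp Require Import measurable_realfun ess_sup_inf.
From mathcomp Require Import ring lra.

Import Order.TTheory GRing.Theory Num.Theory.
Import numFieldNormedType.Exports.

Local Open Scope classical_set_scope.
Local Open Scope ring_scope.
Local Open Scope ereal_scope.

(** * Essential suprema over intervals *)

(** The obstacle is the value +oo. Where v vanishes, the natural extremal h is +oo and may have
    infinite norm, and N x itself may be +oo. So duality is used in approximate form: for each real
    M with 0 < M < N x some h of finite norm has Sh x > 0 and M ||h|| <= 2 Sh x. For p = oo the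
    function 1/v serves directly, for p = 1 indicators of bounded sets, for 1 < p < oo truncations.
    The other half, Sh x <= 2 N x ||h||, is asked only for finite N x and ||h||: if N x = +oo, an h
    living where v vanishes has norm 0, and oo * 0 = 0 bounds nothing. One factor 2 is allowed for
    every p; with the 3 of the overview it gives 6. *)

Section EssentialSupremum.
Set Implicit Arguments.
Unset Strict Implicit.
Context {R : realType}.
Implicit Types (i : interval R) (f : R -> \bar R).
Local Notation mu := (@lebesgue_measure R).

Lemma ae_lebesgueS (P Q : R -> Prop) : (forall x, P x -> Q x) ->
  {ae mu, forall x, P x} -> {ae mu, forall x, Q x}.
Proof. by move=> PQ; apply: filterS => //; exact: (ae_filter_ringOfSetsType mu). Qed.

(** A set is null for the restricted measure exactly when its trace on the interval is Lebesgue
    null, so all later arguments can stay with Lebesgue measure. *)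
Lemma esssup_leP i f (y : \bar R) :
  esssup i f <= y <-> {ae mu, forall x, x \in i -> f x <= y}.
Proof.
split=> [/ess_supP [N [mN N0 sN]]|[N [mN N0 sN]]].
  exists (N `&` [set` i]); split => //.
    by apply: measurableI => //; exact: measurable_itv.
  move=> x /= nfx; have xi : x \in i by apply: contrapT => xi; apply: nfx.
  by split=> //; apply: sN => /= fx; apply: nfx.
apply/ess_supP; exists (N `|` ~` [set` i]); split.
- by apply: measurableU => //; apply: measurableC; exact: measurable_itv.
- rewrite [LHS]/(mu (_ `&` [set` i])) setIUl setICl setU0.
  apply: (subset_measure0 _ mN _ N0) => //.
  by apply: measurableI => //; exact: measurable_itv.
- move=> x /= nfx; have [xi|xi] := pselect (x \in i); last by right.
  by left; apply: sN => /= /(_ xi).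
Qed.

Lemma esssup_ge i f : {ae mu, forall x, x \in i -> f x <= esssup i f}.
Proof. exact/esssup_leP. Qed.

(** Positive measure matters: over a null interval the essential supremum is -oo. *)
Lemma esssup_ge0 i f : 0 < mu [set` i] -> (forall x, x \in i -> 0 <= f x) ->
  0 <= esssup i f.
Proof.
move=> i0 f0; apply: ess_sup_gee; first by rewrite [X in _ < X]/(mu (_ `&` [set` i])) setTI.
exists (~` [set` i]); split.
- by apply: measurableC; exact: measurable_itv.
- by rewrite [LHS]/(mu (_ `&` [set` i])) setICl measure0.
- by move=> x /= nf xi; apply: nf; exact: f0.
Qed.

Lemma lebesgue_measure_itvoy (a : R) : mu `]a, +oo[ = +oo.
Proof. by rewrite lebesgue_measure_itv/= ltry. Qed.

End EssentialSupremum.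

(** * Measurability of the extended inverse *)

Section MeasurableInverse.
Set Implicit Arguments.
Unset Strict Implicit.
Context {d} {T : measurableType d} {R : realType}.

Lemma measurable_inve_EFin (D : set T) (g : T -> R) : measurable_fun D g ->
  (forall x, D x -> (0 <= g x)%R) -> measurable_fun D (fun x => (g x)%:E^-1).
Proof.
move=> mg g0.
(* Away from 0 the inverse is a real power, which is measurable; the value 1/0 = +oo is split
   off. *)
pose F (r : R) : \bar R := if r == 0%R then +oo else (r `^ (-1))%:E.
apply: (@eq_measurable_fun _ _ _ _ _ (F \o g)).
  move=> x; rewrite inE => Dx; rewrite /F/= inver; case: ifP => // _.
  by rewrite powR_inv1 ?g0.
apply: measurableT_comp => //; apply: measurable_fun_ifT => //.
- apply: measurable_fun_eqr => //.
- by apply/measurable_EFinP; exact: measurable_powR.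
Qed.

End MeasurableInverse.

(** * Reduction to a weighted dual norm *)

Section Stieltjes.
Set Implicit Arguments.
Unset Strict Implicit.
Context {R : realType}.
Context (u : R -> R) (aU : admissible (primitive u)).
Implicit Types (v w : R -> R) (h : R -> \bar R) (x s t : R).
Local Notation mu := (@lebesgue_measure R).
Local Notation U := (primitive u).
Local Notation W := (sup_w_calU u).
Local Notation D := (`]0%R, +oo[%classic : set R).

Lemma primitive_lt s t : (0 <= s)%R -> (s < t)%R -> (U s < U t)%R.
Proof.
move=> s0 st; case: aU => _ incU _ _.
by apply: incU => //; rewrite in_itv/= andbT// (le_trans s0)// ltW.
Qed.

Lemma primitive_le s t : (0 <= s)%R -> (s <= t)%R -> (U s <= U t)%R.
Proof. by move=> s0; rewrite le_eqVlt => /predU1P[->//|/primitive_lt-/(_ s0)/ltW]. Qed.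

Lemma primitive_gt0 t : (0 < t)%R -> (0 < U t)%R.
Proof. by move=> t0; have [_ _ <- _] := aU; exact: primitive_lt. Qed.

Lemma primitive_continuous : {in D, continuous U}.
Proof.
have [cU _ _ _] := aU.
rewrite -continuous_open_subspace; last exact: interval_open.
apply: continuous_subspaceW cU => t /=.
by rewrite !in_itv/= !andbT => /ltW.
Qed.

Lemma measurable_primitive : measurable_fun D U.
Proof.
apply: open_continuous_measurable_fun; last exact: primitive_continuous.
exact: interval_open.
Qed.

(** Comparison points are taken rational so that the null sets attached to them form a countable
    family. *)
Lemma primitive_rat c s : (0 < s)%R -> (c < U s)%R ->
  exists r : rat, [/\ (0 < (ratr r : R))%R, (ratr r < s)%R & (c < U (ratr r))%R].
Proof.
move=> s0 cs.
have sD : s \in D by rewrite inE/= in_itv/= s0.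
have /cvgr_gt /(_ _ cs) /= := primitive_continuous sD.
move=> /nbhs_ballP [e /= e0 eU].
have /rat_in_itvoo [r] : (Num.max 0 (s - e) < s)%R.
  by rewrite gt_max s0 ltrBlDr ltrDl.
rewrite in_itv/= gt_max => /andP[/andP[r0 r1] r2].
exists r; split => //; apply: eU.
by rewrite /ball/= ltr_distlC r1 /= (lt_trans r2)// ltrDl.
Qed.

(** * The kernel and the transform *)

Definition kernel x t : R := ((U x + U t)^-1)%R.

Lemma kernel_gt0 x t : (0 < x)%R -> (0 < t)%R -> (0 < kernel x t)%R.
Proof. by move=> x0 t0; rewrite invr_gt0 addr_gt0// primitive_gt0. Qed.

Lemma measurable_kernel x : (0 < x)%R -> measurable_fun D (kernel x).
Proof.
move=> x0; apply: (@eq_measurable_fun _ _ _ _ _ (fun t => (U x + U t) `^ (-1))%R).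
  move=> t; rewrite inE/= in_itv/= andbT => t0.
  by rewrite powR_inv1// addr_ge0// ltW// primitive_gt0.
apply: (measurableT_comp (measurable_powR _)).
by apply: measurable_funD => //; exact: measurable_primitive.
Qed.

Lemma stieltjesE h x : (0 < x)%R ->
  stieltjes u h x = \int[mu]_(t in D) (h t * (kernel x t)%:E).
Proof.
move=> x0; apply: eq_integral => t; rewrite inE/= in_itv/= andbT => t0.
by rewrite inver gt_eqF// addr_gt0// primitive_gt0.
Qed.

Lemma measurable_stieltjes h x : Mplus h -> (0 < x)%R ->
  measurable_fun D (fun t => h t * (kernel x t)%:E).
Proof.
move=> [mh _] x0; apply: emeasurable_funM => //.
by apply/measurable_EFinP; exact: measurable_kernel.
Qed.

Lemma stieltjes_ge0 h x : Mplus h -> (0 < x)%R -> 0 <= stieltjes u h x.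
Proof.
move=> [_ h0] x0; rewrite stieltjesE//; apply: integral_ge0 => t /=.
rewrite in_itv/= andbT => t0.
by rewrite mule_ge0 ?h0// lee_fin ltW// kernel_gt0.
Qed.

Lemma le_kernel_stieltjes h x s (c : R) : Mplus h -> (0 < x)%R -> (0 < s)%R ->
  (0 <= c)%R ->
  (forall t, (0 < t)%R -> c * kernel x t <= kernel s t)%R ->
  c%:E * stieltjes u h x <= stieltjes u h s.
Proof.
move=> Mh x0 s0 c0 ck; rewrite !stieltjesE//.
have hk0 y t : (0 < y)%R -> D t -> 0 <= h t * (kernel y t)%:E.
  rewrite /= in_itv/= andbT => y0 t0.
  by rewrite mule_ge0 ?(proj2 Mh)// lee_fin ltW// kernel_gt0.
rewrite -ge0_integralZl_EFin//; [|by move=> t; exact: hk0|exact: measurable_stieltjes].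
apply: ge0_le_integral => //.
- by move=> t Dt; rewrite mule_ge0// hk0.
- by apply: emeasurable_funM => //; exact: measurable_stieltjes.
- exact: measurable_stieltjes.
- move=> t /=; rewrite in_itv/= andbT => t0.
  rewrite muleCA -EFinM lee_wpmul2l ?(proj2 Mh)// lee_fin; exact: ck.
Qed.

Lemma stieltjes_nonincr h x s : Mplus h -> (0 < x)%R -> (x <= s)%R ->
  stieltjes u h s <= stieltjes u h x.
Proof.
move=> Mh x0 xs; have s0 := lt_le_trans x0 xs.
rewrite -[leLHS]mul1e; apply: le_kernel_stieltjes => // t t0; rewrite mul1r.
have := primitive_gt0 x0; have := primitive_gt0 t0; have := primitive_le (ltW x0) xs.
move=> ? ? ?.
by rewrite lef_pV2 ?posrE; lra.
Qed.

Lemma calU_stieltjes h x s : Mplus h -> (0 < x)%R -> (0 < s)%R ->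
  (calU U x s)%:E * stieltjes u h x <= stieltjes u h s.
Proof.
move=> Mh x0 s0; have Ux := primitive_gt0 x0; have Us := primitive_gt0 s0.
apply: le_kernel_stieltjes => //; first by rewrite divr_ge0 ?addr_ge0// ltW.
move=> t t0; have Ut := primitive_gt0 t0.
rewrite /calU /kernel -mulrA -invfM ler_pdivrMr; last by rewrite mulr_gt0// addr_gt0.
(* After cross-multiplication the two sides differ by U s * U t + U x ^ 2. *)
rewrite mulrC ler_pdivlMr ?addr_gt0//; nra.
Qed.

(** * Comparison of W x * Sh x with the norm of Sh *)

Lemma sup_w_calU_ge0 w x : weight w -> (0 < x)%R -> 0 <= W w x.
Proof.
move=> [_ w0] x0; apply: esssup_ge0; first by rewrite lebesgue_measure_itvoy.
move=> s; rewrite in_itv/= andbT => s0.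
by rewrite -EFinM lee_fin mulr_ge0 ?w0// divr_ge0 ?addr_ge0// ltW// primitive_gt0.
Qed.

Lemma wnorm_ge0 (p : \bar R) v h : weight v -> 0 <= wnorm p v h.
Proof.
move=> [_ v0]; case: p => [p| |] //=.
  by exact: poweR_ge0.
apply: esssup_ge0; first by rewrite lebesgue_measure_itvoy.
by move=> s; rewrite in_itv/= andbT => s0; rewrite mule_ge0 ?lee_fin ?v0.
Qed.

Lemma sup_w_calU_stieltjes w h x : weight w -> Mplus h -> (0 < x)%R ->
  W w x * stieltjes u h x <= wnorm +oo w (stieltjes u h).
Proof.
move=> ww Mh x0; have Sx0 := stieltjes_ge0 Mh x0.
have W0 := sup_w_calU_ge0 ww x0.
have L0 := wnorm_ge0 +oo (stieltjes u h) ww.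
have : {ae mu, forall s, s \in `]0%R, +oo[ -> (w s)%:E * (calU U x s)%:E *
    stieltjes u h x <= wnorm +oo w (stieltjes u h)}.
  have := esssup_ge `]0%R, +oo[ (fun s => `|stieltjes u h s| * (w s)%:E).
  apply: ae_lebesgueS => s /[swap] s0 /(_ s0); apply: le_trans.
  move: s0; rewrite in_itv/= andbT => s0.
  rewrite gee0_abs ?stieltjes_ge0// -muleA muleC.
  by rewrite lee_wpmul2r ?calU_stieltjes// lee_fin; case: ww => _; exact.
set L := wnorm _ _ _ in L0 *; move: (stieltjes u h x) Sx0 => [r||]// Sx0 aeL.
- move: Sx0; rewrite lee_fin le_eqVlt => /predU1P[<-|r0]; first by rewrite mule0.
  rewrite -lee_pdivlMr//; apply/esssup_leP; apply: ae_lebesgueS aeL => s /[swap] s0 /(_ s0).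
  by rewrite lee_pdivlMr.
(* Here Sh x = +oo. A finite L forces the integrand of W to vanish a.e., so W = 0 and 0 * oo = 0. *)
- have [->|Ly] := eqVneq L +oo; first by rewrite leey.
  suff : W w x <= 0 by move=> W0'; rewrite (@le_anti _ _ (W w x) 0) ?W0' ?W0// mul0e.
  apply/esssup_leP; apply: ae_lebesgueS aeL => s /[swap] s0 /(_ s0).
  move=> wL; rewrite leNgt; apply/negP => ws0.
  by move: wL; rewrite gt0_muley// leye_eq (negbTE Ly).
Qed.

Lemma wnormy_stieltjes_le w h (K : \bar R) : weight w -> Mplus h -> 
  (forall x, (0 < x)%R -> W w x * stieltjes u h x <= K) ->
  wnorm +oo w (stieltjes u h) <= 3%:E * K.
Proof.
move=> ww Mh WK.
(* The null set outside which W bounds its integrand depends on the point; numbering the rationals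
   by [unpickle] yields a single null set valid for all of them. *)
pose P (n : nat) (s : R) := forall r : rat, unpickle n = Some r -> (0 < (ratr r : R))%R ->
  (0 < s)%R -> (w s)%:E * (calU U (ratr r) s)%:E <= W w (ratr r).
have : {ae mu, forall s n, P n s}.
  apply: ae_foralln => n; rewrite /P; case: (unpickle n) => [r|]; last first.
    by apply: aeW => s.
  have := esssup_ge `]0%R, +oo[ (fun s => (w s)%:E * (calU U (ratr r) s)%:E).
  apply: ae_lebesgueS => s rs q [<-] r0 s0; apply: rs.
  by rewrite in_itv/= s0.
move=> aeP; apply/esssup_leP; apply: ae_lebesgueS aeP => s Ps.
rewrite in_itv/= andbT => s0; have Us := primitive_gt0 s0.
have [r [r0 rs]] : exists r : rat, [/\ (0 < (ratr r : R))%R, (ratr r < s)%R &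
    (U s / 2 < U (ratr r))%R].
  by apply: primitive_rat => //; rewrite ltr_pdivrMr//; lra.
move=> Ur; rewrite gee0_abs ?stieltjes_ge0//.
have ws : (0 <= w s)%R by case: ww => _; exact.
have := Ps (pickle r) r (pickleK r) r0 s0 => wr.
(* a / (U s + a) increases in a and equals 1/3 at a = U s / 2. *)
have wc : (w s)%:E <= 3%:E * W w (ratr r).
  apply: le_trans (lee_wpmul2l _ wr) => //.
  rewrite muleCA -!EFinM lee_fin ler_peMr// /calU.
  by rewrite mulrA ler_pdivlMr ?addr_gt0// ?primitive_gt0//; lra.
apply: (@le_trans _ _ (stieltjes u h (ratr r) * (3%:E * W w (ratr r)))).
  have rs' := stieltjes_nonincr Mh r0 (ltW rs).
  by apply: (lee_pmul (stieltjes_ge0 Mh s0) _ rs' wc); rewrite lee_fin.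
by rewrite muleC -muleA lee_wpmul2l// WK.
Qed.

(** Lets a dual norm b, possibly +oo and not attained, be tested through the reals below it. The
    bound [0 <= K] settles b = 0, where no [M] is available. *)
Lemma mule_le_approx (a b K : \bar R) : 0 <= a -> 0 <= b -> 0 <= K ->
  (forall M : R, (0 < M)%R -> M%:E < b -> a * M%:E <= K) -> a * b <= K.
Proof.
move=> a0 b0 K0 abK.
have [->|Ky] := eqVneq K +oo; first by rewrite leey.
have [->|bn0] := eqVneq b 0; first by rewrite mule0.
have bgt0 : 0 < b by rewrite lt_neqAle eq_sym bn0.
have [->|an0] := eqVneq a 0; first by rewrite mul0e.
have agt0 : 0 < a by rewrite lt_neqAle eq_sym an0.
have [k kK] : exists k : R, K = k%:E.
  by exists (fine K); rewrite fineK// ge0_fin_numE// ltey.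
(* [M0] refutes a = +oo, and for finite a it keeps the [M] chosen between K / a and b positive. *)
have [M0 M00 M0b] : exists2 M : R, (0 < M)%R & M%:E < b.
  move: b bgt0 {b0 bn0 abK} => [r||]// r0; last by exists 1%R; rewrite ?ltry.
  by exists (r / 2)%R; rewrite ?lte_fin in r0 *; lra.
move: a a0 an0 agt0 abK => [r||]// a0 an0 agt0 abK; last first.
  by have := abK _ M00 M0b; rewrite gt0_mulye ?lte_fin// leye_eq (negbTE Ky).
rewrite -lee_pdivlMl// kK -EFinM leNgt; apply/negP => kb.
have [M M0' [Mb kM]] : exists2 M : R, (M0 <= M)%R & M%:E < b /\ (r^-1 * k < M)%R.
  move: b kb M0b {b0 bgt0 bn0 abK} => [b||]//.
    rewrite !lte_fin => kb M0b.
    exists (Num.max M0 ((r^-1 * k + b) / 2))%R; first by rewrite le_max lexx.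
    by rewrite lte_fin gt_max M0b lt_max; split; [lra|apply/orP; right; lra].
  move=> _ _; exists (Num.max M0 (r^-1 * k + 1))%R; first by rewrite le_max lexx.
  by rewrite ltry lt_max; split => //; apply/orP; right; lra.
have := abK M (lt_le_trans M00 M0') Mb.
by rewrite kK -lee_pdivlMl// -EFinM lee_fin leNgt kM.
Qed.

(* [B x] plays the role of the norm, in the dual of the weighted space, of
   [t |-> 1 / (U x + U t)], up to a factor 2. *)
Lemma stieltjes_ineq_dual v w (p : \bar R) (B : R -> \bar R) :
  weight v -> weight w ->
  (forall x, (0 < x)%R -> 0 <= B x) ->
  (forall x h, (0 < x)%R -> Mplus h -> B x < +oo -> wnorm p v h < +oo ->
     stieltjes u h x <= 2%:E * (B x * wnorm p v h)) ->
  (forall x (M : R), (0 < x)%R -> (0 < M)%R -> M%:E < B x ->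
     exists h, [/\ Mplus h, wnorm p v h < +oo, 0 < stieltjes u h x &
       M%:E * wnorm p v h <= 2%:E * stieltjes u h x]) ->
  let S := ereal_sup [set W w x * B x | x in `]0%R, +oo[] in
  ((exists2 c : R, (0 <= c)%R & stieltjes_ineq u v w p c) <-> S < +oo) /\
  equiv_upto 6 (best_constant u v w p) S.
Proof.
move=> wv ww B0 Bub Blb S.
have S_le c : (0 <= c)%R -> stieltjes_ineq u v w p c -> S <= 2%:E * c%:E.
  move=> c0 ineq; apply: ge_ereal_sup => _ [x /= + <-]; rewrite in_itv/= andbT => x0.
  have W0 := sup_w_calU_ge0 ww x0.
  apply: mule_le_approx; rewrite ?B0// ?mule_ge0//.
  move=> M M0 MB; have [h [Mh n_fin S0 MS]] := Blb _ _ x0 M0 MB.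
  have n0 := wnorm_ge0 p h wv.
  have WS : W w x * stieltjes u h x <= c%:E * wnorm p v h.
    by apply: le_trans (ineq _ Mh); exact: sup_w_calU_stieltjes.
  (* Division by the norm is impossible when it is 0; then Sh x > 0 forces W = 0. *)
  have [nE|n_neq0] := eqVneq (wnorm p v h) 0.
    move: WS; rewrite nE mule0 => WS.
    suff -> : W w x = 0 by rewrite mul0e mule_ge0.
    apply/eqP; rewrite eq_le W0 andbT leNgt; apply/negP => W_gt0.
    by move: WS; rewrite leNgt mule_gt0.
  have n_gt0 : 0 < wnorm p v h by rewrite lt_neqAle eq_sym n_neq0.
  rewrite -(@lee_pmul2r _ (wnorm p v h)) ?ge0_fin_numE// -!muleA.
  apply: (@le_trans _ _ (W w x * (2%:E * stieltjes u h x))); first by rewrite lee_wpmul2l.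
  by rewrite [leLHS]muleCA lee_wpmul2l.
(* 6 = 3 * 2, from [wnormy_stieltjes_le] and [Bub]. Strict positivity of c makes the right-hand side
   +oo when the norm of h is +oo. *)
have ineq_of c : (0 < c)%R -> 6%:E * S <= c%:E -> stieltjes_ineq u v w p c.
  move=> c0 Sc h Mh.
  have [->|n_fin] := eqVneq (wnorm p v h) +oo.
    by rewrite gt0_muley ?lte_fin// leey.
  have n0 := wnorm_ge0 p h wv.
  apply: (@le_trans _ _ (3%:E * (2%:E * S * wnorm p v h))); last first.
    rewrite !muleA lee_wpmul2r// -EFinM; apply: le_trans Sc.
    by rewrite (_ : (3 * 2 = 6)%R); last lra.
  apply: wnormy_stieltjes_le => // x x0.
  have W0 := sup_w_calU_ge0 ww x0.
  have WB : W w x * B x <= S.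
    by apply: ereal_sup_ubound; exists x => //=; rewrite in_itv/= x0.
  have S0 : 0 <= S by apply: le_trans WB; rewrite mule_ge0 ?B0.
  (* When W = 0 a finite S says nothing about B x; otherwise it forces B x to be finite, as [Bub]
     requires. *)
  have [->|Wn0] := eqVneq (W w x) 0; first by rewrite mul0e !mule_ge0.
  have Wgt0 : 0 < W w x by rewrite lt_neqAle eq_sym Wn0.
  have B_fin : B x < +oo.
    rewrite ltey; apply/eqP => By; move: Sc; rewrite leNgt => /negP; apply.
    move: WB; rewrite By gt0_muley// leye_eq => /eqP ->.
    by rewrite gt0_muley ?ltry// lte_fin.
  apply: (@le_trans _ _ (W w x * (2%:E * (B x * wnorm p v h)))).
    by rewrite lee_wpmul2l// Bub// ltey.
  by rewrite [leLHS]muleCA -[leRHS]muleA lee_wpmul2l// muleA lee_wpmul2r.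
have S0 : 0 <= S.
  apply: (@le_trans _ _ (W w 1%R * B 1%R)).
    by rewrite mule_ge0 ?B0// sup_w_calU_ge0.
  by apply: ereal_sup_ubound; exists 1%R => //=; rewrite in_itv/= ltr01.
split; [split|split].
- move=> [c c0 /(S_le _ c0)] /le_lt_trans; apply; by rewrite -EFinM ltry.
- move=> Sfin; have Sf : S \is a fin_num by rewrite ge0_fin_numE.
  (* The added 1, and e below, keep the constant positive even if S = 0. *)
  have c0 : (0 < 6 * fine S + 1)%R by have := fine_ge0 S0; lra.
  exists (6 * fine S + 1)%R; first exact: ltW.
  by apply: ineq_of => //; rewrite -{1}(fineK Sf) -EFinM lee_fin; lra.
- rewrite lee_pdivrMl//; have [->|Sfin] := eqVneq S +oo.
    by rewrite gt0_muley ?leey// lte_fin.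
  have Sf : S \is a fin_num by rewrite ge0_fin_numE// ltey.
  apply/lee_addgt0Pr => e e0; rewrite -(fineK Sf) -EFinM -EFinD.
  have c0 : (0 < 6 * fine S + e)%R by have := fine_ge0 S0; lra.
  apply: ereal_inf_lbound; exists (6 * fine S + e)%R => //; split; first exact: ltW.
  by apply: ineq_of => //; rewrite -{1}(fineK Sf) -EFinM lee_fin; lra.
- rewrite -lee_pdivrMl//; apply: le_ereal_inf_tmp => _ [c [c0 ineq] <-].
  rewrite lee_pdivrMl//; apply: le_trans (S_le _ c0 ineq) _.
  by rewrite -!EFinM lee_fin; lra.
Qed.

End Stieltjes.

(** * The dual norms for p = oo, p = 1 and 1 < p < oo *)

Section WeightedDualNorm.
Set Implicit Arguments.
Unset Strict Implicit.
Context {R : realType}.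
Context (u : R -> R) (aU : admissible (primitive u)).
Implicit Types (v : R -> R) (h : R -> \bar R) (x s t : R).
Local Notation mu := (@lebesgue_measure R).
Local Notation U := (primitive u).
Local Notation D := (`]0%R, +oo[%classic : set R).

Lemma stieltjes_gt0 h x (A : set R) : Mplus h -> (0 < x)%R ->
  measurable A -> A `<=` D -> 0 < mu A -> (forall t, A t -> 0 < h t) ->
  0 < stieltjes u h x.
Proof.
move=> Mh x0 mA AD A0 hA; rewrite lt_neqAle stieltjes_ge0// andbT eq_sym.
apply/eqP; rewrite stieltjesE// => S0.
have : \int[mu]_(t in D) `|h t * (kernel u x t)%:E| = 0.
  rewrite -[RHS]S0; apply: eq_integral => t; rewrite inE/= in_itv/= andbT => t0.
  by rewrite gee0_abs// mule_ge0 ?(proj2 Mh)// lee_fin ltW// kernel_gt0.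
move/ae_eq_integral_abs => /(_ (measurable_itv _) (measurable_stieltjes aU Mh x0)).
move=> [N [mN N0 sN]]; suff AN : A `<=` N.
  by move: A0; rewrite (_ : mu A = 0) ?ltxx//; apply: subset_measure0 N0.
move=> t At; apply: sN => /= /(_ (AD _ At)) /eqP.
have := AD _ At; rewrite /= in_itv/= andbT => t0.
by rewrite gt_eqF// mule_gt0 ?hA// lte_fin kernel_gt0.
Qed.

(** * The case p = oo *)

Definition dual_normy v x : \bar R :=
  \int[mu]_(t in D) ((kernel u x t)%:E * (v t)%:E^-1).

Lemma dual_normyE v x : (0 < x)%R ->
  \int[mu]_(t in D) ((calU U t x)%:E * (U t)%:E^-1 * (v t)%:E^-1) = dual_normy v x.
Proof.
move=> x0; apply: eq_integral => t; rewrite inE/= in_itv/= andbT => t0.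
have Ut := primitive_gt0 aU t0.
by rewrite inver gt_eqF// -EFinM mulrAC divff ?mul1r// gt_eqF.
Qed.

Lemma Mplus_inve v : weight v -> Mplus (fun t => (v t)%:E^-1).
Proof.
move=> [[mv _ _] v0]; split; last by move=> x x0; rewrite inve_ge0 lee_fin v0.
by apply: measurable_inve_EFin => // x /=; rewrite in_itv/= andbT; exact: v0.
Qed.

Lemma dual_normy_ub v x h : weight v -> (0 < x)%R -> Mplus h ->
  dual_normy v x < +oo -> wnorm +oo v h < +oo ->
  stieltjes u h x <= dual_normy v x * wnorm +oo v h.
Proof.
move=> wv x0 Mh By ny; have n0 := wnorm_ge0 +oo h wv.
have [mi i0] := Mplus_inve wv.
have f0 t : D t -> 0 <= (kernel u x t)%:E * (v t)%:E^-1.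
  rewrite /= in_itv/= andbT => t0.
  by rewrite mule_ge0// ?i0// lee_fin ltW// kernel_gt0.
have mf : measurable_fun D (fun t => (kernel u x t)%:E * (v t)%:E^-1).
  by apply: emeasurable_funM => //; apply/measurable_EFinP; exact: measurable_kernel.
have B0 : 0 <= dual_normy v x by exact: integral_ge0.
(* Where v vanishes the norm gives no control of h, and the majorant must be +oo there. If the norm
   is 0, the product 0 * oo would be 0; adding e avoids this. *)
have le_add e : (0 < e)%R -> stieltjes u h x <= (wnorm +oo v h + e%:E) * dual_normy v x.
  move=> e0; have ne0 : 0 < wnorm +oo v h + e%:E.
    by rewrite (@lt_le_trans _ _ e%:E) ?lte_fin// leeDr.
  rewrite /dual_normy -ge0_integralZl ?(ltW ne0)// stieltjesE//.
  apply: ae_ge0_le_integral => //.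
  - move=> t /=; rewrite in_itv/= andbT => t0.
    by rewrite mule_ge0 ?(proj2 Mh)// lee_fin ltW// kernel_gt0.
  - exact: measurable_stieltjes.
  - by move=> t Dt; rewrite mule_ge0 ?f0// ltW.
  - exact: emeasurable_funM.
  have := esssup_ge `]0%R, +oo[ (fun s => `|h s| * (v s)%:E).
  apply: ae_lebesgueS => t + t0; move=> /(_ t0); move: t0; rewrite /= in_itv/= andbT => t0.
  rewrite gee0_abs ?(proj2 Mh)// -/(wnorm +oo v h) => hv.
  rewrite muleCA [leLHS]muleC lee_wpmul2l ?lee_fin ?(ltW (kernel_gt0 _ _ _))//.
  have := proj2 wv _ t0; rewrite le_eqVlt => /predU1P[<-|v0].
    by rewrite inve0 gt0_muley// leey.
  rewrite inver gt_eqF// lee_pdivlMr//; apply: le_trans hv _.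
  by rewrite leeDl// lee_fin ltW.
have Bf : dual_normy v x \is a fin_num by rewrite ge0_fin_numE.
have b0 := fine_ge0 B0.
apply/lee_addgt0Pr => e e0.
have e1 : (0 < e / (fine (dual_normy v x) + 1))%R by rewrite divr_gt0// ltr_wpDl.
apply: le_trans (le_add _ e1) _.
rewrite muleDl ?ge0_adde_def ?inE ?lee_fin ?(ltW e1)//.
rewrite muleC leeD2l// -{2}(fineK Bf) -EFinM lee_fin mulrAC ler_pdivrMr ?ltr_wpDl//.
by rewrite ler_pM2l//; lra.
Qed.

Lemma dual_normy_lb v x (M : R) : weight v -> (0 < x)%R -> (0 < M)%R ->
  M%:E < dual_normy v x ->
  exists h, [/\ Mplus h, wnorm +oo v h < +oo, 0 < stieltjes u h x &
    M%:E * wnorm +oo v h <= stieltjes u h x].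
Proof.
move=> wv x0 M0 MB; have Mh := Mplus_inve wv.
(* Its norm is at most 1 even where v = 0, since oo * 0 = 0, and its transform at x is the dual norm
   itself. *)
exists (fun t => (v t)%:E^-1).
have SE : stieltjes u (fun t => (v t)%:E^-1) x = dual_normy v x.
  by rewrite stieltjesE//; apply: eq_integral => t _; rewrite muleC.
have n1 : wnorm +oo v (fun t => (v t)%:E^-1) <= 1.
  apply/esssup_leP; apply: aeW => t; rewrite in_itv/= andbT => t0.
  rewrite gee0_abs ?(proj2 Mh)//.
  have := proj2 wv _ t0; rewrite le_eqVlt => /predU1P[<-|v0].
    by rewrite mule0.
  by rewrite inver gt_eqF// -EFinM mulVf// gt_eqF.
rewrite SE; split => //.
- by rewrite (le_lt_trans n1)// ltry.
- by apply: lt_trans MB; rewrite lte_fin.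
- apply: le_trans (ltW MB); rewrite -[leRHS]mule1 lee_wpmul2l// lee_fin; exact: ltW.
Qed.

(** * The case p = 1 *)

Definition dual_norm1 v x : \bar R := (U x)%:E^-1 *
  ereal_sup [set (U t)%:E * esssup `]t, +oo[ (fun s => ((U s)%:E * (v s)%:E)^-1)
            | t in `]0%R, x[].

Lemma wnorm1E v h : weight v -> Mplus h -> wnorm 1%:E v h = \int[mu]_(t in D) (h t * (v t)%:E).
Proof.
move=> [_ v0] [_ h0]; rewrite /= invr1.
have -> : \int[mu]_(x in D) (`|h x| `^ 1 * (v x)%:E) = \int[mu]_(t in D) (h t * (v t)%:E).
  apply: eq_integral => t; rewrite inE/= in_itv/= andbT => t0.
  by rewrite poweRe1 ?abse_ge0// gee0_abs ?h0.
rewrite poweRe1//; apply: integral_ge0 => t /=; rewrite in_itv/= andbT => t0.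
by rewrite mule_ge0 ?h0// lee_fin v0.
Qed.

Lemma dual_norm1_ge0 v x : weight v -> (0 < x)%R -> 0 <= dual_norm1 v x.
Proof.
move=> [_ v0] x0; have Ux := primitive_gt0 aU x0.
rewrite mule_ge0//; first by rewrite inve_ge0 lee_fin ltW.
have y0 : (0 < x / 2)%R by rewrite divr_gt0.
have Uy := primitive_gt0 aU y0.
apply: (@le_trans _ _ ((U (x / 2))%:E *
  esssup `](x / 2)%R, +oo[ (fun s => ((U s)%:E * (v s)%:E)^-1))).
  rewrite mule_ge0 ?lee_fin ?(ltW Uy)//.
  apply: esssup_ge0; first by rewrite lebesgue_measure_itvoy.
  move=> s; rewrite in_itv/= andbT => ys; have s0 := lt_trans y0 ys.
  by rewrite inve_ge0 mule_ge0 ?lee_fin ?v0// ltW// primitive_gt0.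
apply: ereal_sup_ubound; exists (x / 2)%R => //=.
by rewrite in_itv/= y0/= ltr_pdivrMr//; lra.
Qed.

(** The hypotheses on d give 1/2 < c * y. It is applied with a and c the smaller and the larger of U
    s and U x, and d the value of U at a rational point. *)
Lemma one_le_mul_add (a c d y : R) : (0 < a)%R -> (0 < c)%R -> (0 <= y)%R ->
  (a / 2 < d)%R -> (d <= c * y * a)%R -> (1 <= 2 * y * (a + c))%R.
Proof.
move=> a0 c0 y0 ad dc; have : (a * 2^-1 <= a * (c * y))%R by lra.
by rewrite ler_pM2l// => ?; have := mulr_ge0 y0 (ltW a0); lra.
Qed.

(** Exchanging the suprema turns [dual_norm1] into the ess sup over s of 1 / (max (U x) (U s) * v
    s), because U t can approach min (U x) (U s). A rational t reaching half of that minimum is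
    enough here, at the cost of the factor 2. *)
Lemma kernel_le_dual_norm1 v x : weight v -> (0 < x)%R -> dual_norm1 v x < +oo ->
  {ae mu, forall s, D s -> (kernel u x s <= 2 * fine (dual_norm1 v x) * v s)%R}.
Proof.
move=> wv x0 By; have B0 := dual_norm1_ge0 wv x0.
have Bf : dual_norm1 v x \is a fin_num by rewrite ge0_fin_numE.
have Ux := primitive_gt0 aU x0.
pose E t := esssup `]t, +oo[ (fun s => ((U s)%:E * (v s)%:E)^-1).
pose b := fine (dual_norm1 v x).
have UE t : (0 < t)%R -> (t < x)%R -> (U t)%:E * E t <= (U x * b)%:E.
  move=> t0 tx; rewrite EFinM -lee_pdivrMl// /b (fineK Bf) /dual_norm1 inver gt_eqF//.
  rewrite lee_wpmul2l ?lee_fin ?invr_ge0 ?(ltW Ux)//.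
  by apply: ereal_sup_ubound; exists t => //=; rewrite in_itv/= t0.
pose P (n : nat) (s : R) := forall r : rat, unpickle n = Some r ->
  (0 < (ratr r : R))%R -> (ratr r < s)%R ->
  ((U s)%:E * (v s)%:E)^-1 <= E (ratr r).
have : {ae mu, forall s n, P n s}.
  apply: ae_foralln => n; rewrite /P; case: (unpickle n) => [r|]; last first.
    by apply: aeW => s.
  have := esssup_ge `](ratr r : R), +oo[ (fun s => ((U s)%:E * (v s)%:E)^-1).
  apply: ae_lebesgueS => s rs q [<-] r0 s0; apply: rs.
  by rewrite in_itv/= s0.
apply: ae_lebesgueS => s Ps /=; rewrite in_itv/= andbT => s0.
have Us := primitive_gt0 aU s0; have vs := proj2 wv _ s0.
pose m := Num.min s x; have m0 : (0 < m)%R by rewrite lt_min s0.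
have Um := primitive_gt0 aU m0.
have [r [r0 rm Ur]] : exists r : rat, [/\ (0 < ratr r :> R)%R, (ratr r < m)%R &
    (U m / 2 < U (ratr r))%R].
  by apply: (primitive_rat aU) => //; rewrite ltr_pdivrMr//; lra.
move: (rm); rewrite lt_min => /andP[rs rx].
have := UE _ r0 rx; have := Ps (pickle r) r (pickleK r) r0 rs.
have Urr := primitive_gt0 aU r0.
move=> vE UEr; have : (U (ratr r))%:E * ((U s)%:E * (v s)%:E)^-1 <= (U x * b)%:E.
  by apply: le_trans UEr; rewrite lee_wpmul2l// lee_fin ltW.
(* If v s = 0 the inverse is +oo, which contradicts the finite bound. *)
rewrite -EFinM inver; case: eqVneq => [|Uvn0].
  by rewrite gt0_muley// lte_fin => _; rewrite leye_eq.
have Uv : (0 < U s * v s)%R by rewrite lt_neqAle eq_sym Uvn0 mulr_ge0// ltW.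
rewrite -EFinM lee_fin ler_pdivrMr// => key.
have b0 : (0 <= b)%R by exact: fine_ge0.
rewrite /kernel -[X in (X <= _)%R]mul1r ler_pdivrMr ?addr_gt0// -/b.
have bv : (0 <= b * v s)%R by rewrite mulr_ge0.
have := key; have := Ur; rewrite /m /Num.min; case: ifP => sx Ur' key'.
  have -> : (2 * b * v s * (U x + U s) = 2 * (b * v s) * (U s + U x))%R by ring.
  apply: one_le_mul_add Ur' _ => //; apply: le_trans key' _.
  by rewrite le_eqVlt; apply/orP; left; apply/eqP; ring.
have -> : (2 * b * v s * (U x + U s) = 2 * (b * v s) * (U x + U s))%R by ring.
apply: one_le_mul_add Ur' _ => //; apply: le_trans key' _.
by rewrite le_eqVlt; apply/orP; left; apply/eqP; ring.
Qed.

Lemma dual_norm1_ub v x h : weight v -> (0 < x)%R -> Mplus h ->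
  dual_norm1 v x < +oo -> 
  stieltjes u h x <= 2%:E * (dual_norm1 v x * wnorm 1%:E v h).
Proof.
move=> wv x0 Mh By; have B0 := dual_norm1_ge0 wv x0.
have Bf : dual_norm1 v x \is a fin_num by rewrite ge0_fin_numE.
have mv : measurable_fun D (fun t => h t * (v t)%:E).
  apply: emeasurable_funM; first by case: Mh.
  by apply/measurable_EFinP; case: wv => -[].
have hv0 t : D t -> 0 <= h t * (v t)%:E.
  rewrite /= in_itv/= andbT => t0.
  by rewrite mule_ge0 ?(proj2 Mh)// lee_fin (proj2 wv).
rewrite muleA -(fineK Bf) -EFinM wnorm1E// stieltjesE//.
have b0 := fine_ge0 B0.
rewrite -ge0_integralZl_EFin// ?mulr_ge0//.
apply: ae_ge0_le_integral => //.
- move=> t /=; rewrite in_itv/= andbT => t0.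
  by rewrite mule_ge0 ?(proj2 Mh)// lee_fin ltW// kernel_gt0.
- exact: measurable_stieltjes.
- by move=> t Dt; rewrite mule_ge0 ?hv0// lee_fin mulr_ge0.
- by apply: emeasurable_funM.
apply: ae_lebesgueS (kernel_le_dual_norm1 wv x0 By) => t kv Dt.
move: (Dt); rewrite /= in_itv/= andbT => t0.
by rewrite muleCA lee_wpmul2l ?(proj2 Mh)// -EFinM lee_fin kv.
Qed.

Lemma Mplus_indic (A : set R) : measurable A -> Mplus (fun s => (\1_A s)%:E : \bar R).
Proof.
move=> mA; split; last by move=> s _; rewrite lee_fin.
by apply/measurable_EFinP; exact: measurable_indic.
Qed.

Lemma mul_add_le2 (a c d y : R) : (0 < a)%R -> (0 < c)%R -> (d <= a)%R ->
  (d <= c)%R -> (a * c * y <= d)%R -> (y * (a + c) <= 2)%R.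
Proof.
move=> a0 c0 da dc acy.
have : (a * (c * y) <= a * 1)%R by lra.
have : (c * (a * y) <= c * 1)%R by lra.
by rewrite !ler_pM2l//; lra.
Qed.

(** Pick t < x nearly attaining the supremum. Beyond t, 1 / (U v) exceeds c = U x * M / U t on a set
    of positive measure; there M * U x * U s * v s <= U t, and U t <= min (U x) (U s) gives M * v <=
    2 * k_x. The indicator of a bounded piece of this set is the test function. *)
Lemma dual_norm1_lb v x (M : R) : weight v -> (0 < x)%R -> (0 < M)%R ->
  M%:E < dual_norm1 v x ->
  exists h, [/\ Mplus h, wnorm 1%:E v h < +oo, 0 < stieltjes u h x &
    M%:E * wnorm 1%:E v h <= 2%:E * stieltjes u h x].
Proof.
move=> wv x0 M0; have Ux := primitive_gt0 aU x0.
rewrite /dual_norm1 inver gt_eqF// lte_pdivlMl// => /ereal_sup_gt[_ [t /= + <-]].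
rewrite in_itv/= => /andP[t0 tx]; have Ut := primitive_gt0 aU t0.
rewrite -EFinM -lte_pdivrMl// -EFinM; set c := (_^-1 * _)%R => cE.
have c0 : (0 < c)%R by rewrite mulr_gt0 ?invr_gt0// mulr_gt0.
pose f s := ((U s)%:E * (v s)%:E)^-1 : \bar R.
pose A (n : nat) : set R := `]t, (t + n%:R)%R[ `&` [set s | c%:E < f s].
have mf : measurable_fun D f.
  apply: (@measurable_inve_EFin _ _ _ _ (fun s => U s * v s)%R).
    apply: measurable_funM; first exact: measurable_primitive.
    by case: wv => -[].
  move=> s /=; rewrite in_itv/= andbT => s0; rewrite mulr_ge0 ?(proj2 wv)//.
  by rewrite ltW// primitive_gt0.
have AD n : `]t, (t + n%:R)%R[ `<=` D.
  move=> s /=; rewrite !in_itv/= andbT => /andP[ts _]; exact: lt_trans ts.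
have mA n : measurable (A n).
  have : measurable_fun `]t, (t + n%:R)%R[ f by apply: measurable_funS mf.
  move/emeasurable_fun_o_infty; exact.
(* If all [A n] were null, so would be their union, the part of ]t, oo[ where [f] exceeds c, and c
   would bound the ess sup. *)
have [n An] : exists n, mu (A n) != 0.
  apply: contrapT => nA; move: cE; rewrite ltNge => /negP; apply.
  apply/esssup_leP.
  have : {ae mu, forall s n, ~ A n s}.
    apply: ae_foralln => n; exists (A n); split; [exact: mA| |].
      by apply: contrapT => An; apply: nA; exists n; apply/eqP.
    by move=> s nnA; exact: contrapT nnA.
  apply: ae_lebesgueS => s nAs; rewrite in_itv/= andbT => ts.
  rewrite leNgt; apply/negP => cf.
  have st : (0 <= s - t)%R by rewrite subr_ge0 ltW.
  apply: (nAs (Num.bound (s - t))); split => //=.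
  by rewrite in_itv/= ts -ltrBlDl archi_boundP.
have A0 : 0 < mu (A n) by rewrite lt_neqAle eq_sym An measure_ge0.
pose h s : \bar R := (\1_(A n) s)%:E.
have Mh : Mplus h by apply: Mplus_indic; exact: mA.
have mAD := proj1 Mh.
have S0 : 0 < stieltjes u h x.
  apply: (stieltjes_gt0 Mh x0 (mA n)) => //.
    by apply: subset_trans (AD n); exact: subIsetl.
  by move=> s As; rewrite /h indicE mem_set//= lte_fin.
(* Uses k_x <= 1 / U x and the boundedness of [A n]; [MS] then passes finiteness on to the norm of
   h. *)
have Sfin : stieltjes u h x < +oo.
  apply: (@le_lt_trans _ _ ((U x)^-1%:E * mu (A n))); last first.
    rewrite lte_mul_pinfty ?lee_fin ?invr_ge0 ?(ltW Ux)//.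
    apply: (@le_lt_trans _ _ (mu `]t, (t + n%:R)%R[)).
      apply: le_measure; rewrite ?inE; [exact: mA|exact: measurable_itv|exact: subIsetl].
    by rewrite lebesgue_measure_itv/=; case: ifP => // _; rewrite -EFinB ltry.
  have -> : mu (A n) = \int[mu]_(s in D) (\1_(A n) s)%:E.
    rewrite (integral_indic mu (measurable_itv _) (mA n)); congr (mu _).
    by apply/esym/setIidl/(subset_trans _ (AD n)); exact: subIsetl.
  rewrite stieltjesE// -ge0_integralZl_EFin ?invr_ge0 ?(ltW Ux)//.
  apply: ge0_le_integral => //.
  - move=> s /=; rewrite in_itv/= andbT => s0.
    by rewrite mule_ge0 ?(proj2 Mh)// lee_fin ltW// kernel_gt0.
  - exact: measurable_stieltjes.
  - exact: emeasurable_funM.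
  move=> s /=; rewrite in_itv/= andbT => s0; have Us := primitive_gt0 aU s0.
  rewrite muleC lee_wpmul2r ?lee_fin// /kernel lef_pV2 ?posrE ?addr_gt0//.
  by rewrite lerDl ltW.
have MS : M%:E * wnorm 1%:E v h <= 2%:E * stieltjes u h x.
  rewrite wnorm1E// stieltjesE//.
  have mhv : measurable_fun D (fun s => h s * (v s)%:E).
    by apply: emeasurable_funM => //; apply/measurable_EFinP; case: wv => -[].
  have hk0 s : D s -> 0 <= h s * (kernel u x s)%:E.
    rewrite /= in_itv/= andbT => s0.
    by rewrite mule_ge0 ?(proj2 Mh)// lee_fin ltW// kernel_gt0.
  have hv0 s : D s -> 0 <= h s * (v s)%:E.
    rewrite /= in_itv/= andbT => s0.
    by rewrite mule_ge0 ?(proj2 Mh)// lee_fin (proj2 wv).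
  have mhk := measurable_stieltjes aU Mh x0.
  rewrite -!ge0_integralZl_EFin// ?(ltW M0)//.
  apply: ge0_le_integral => //.
  - by move=> s Ds; rewrite mule_ge0 ?hv0// lee_fin ltW.
  - exact: emeasurable_funM.
  - exact: emeasurable_funM.
  move=> s Ds; rewrite muleCA [leRHS]muleCA /h indicE.
  have [/set_mem[]|] := boolP (s \in A n); last by rewrite !mul0e.
  rewrite /= in_itv/= !mul1e -!EFinM lee_fin => /andP[ts _] cf.
  have s0 := lt_trans t0 ts; have Us := primitive_gt0 aU s0; have vs := proj2 wv _ s0.
  have ctE : (c * (U s * v s) <= 1)%R.
    move: cf; rewrite /f -EFinM inver; case: eqVneq => [->|Uvn0].
      by rewrite mulr0 ler01.
    have Uv : (0 < U s * v s)%R by rewrite lt_neqAle eq_sym Uvn0 mulr_ge0// ltW.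
    rewrite lte_fin => /ltW; rewrite -[X in (X <= _)%R -> _]mulr1.
    by rewrite -[X in (_ <= X)%R -> _]mul1r ler_pdivlMr// mulr1.
  have Uts := primitive_lt aU (ltW t0) ts.
  have Utx := primitive_lt aU (ltW t0) tx.
  rewrite /kernel ler_pdivlMr ?addr_gt0//.
  apply: (mul_add_le2 Ux Us (ltW Utx) (ltW Uts)).
  move: ctE; rewrite /c -mulrA ler_pdivrMl// mulr1; apply: le_trans.
  by rewrite le_eqVlt; apply/orP; left; apply/eqP; ring.
suff nfin : wnorm 1%:E v h < +oo by exists h.
have : M%:E * wnorm 1%:E v h < +oo.
  by apply: le_lt_trans MS _; rewrite lte_mul_pinfty.
case: (wnorm 1%:E v h) => [r _||//]; first exact: ltry.
by rewrite gt0_muley ?lte_fin.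
Qed.

(** * Truncations *)

Definition truncate (f : R -> \bar R) (n : nat) (t : R) : \bar R :=
  mine (f t) n%:R%:E * (\1_(`]0%R, n%:R[%classic : set R) t)%:E.

Lemma Mplus_truncate f n : Mplus f -> Mplus (truncate f n).
Proof.
move=> [mf f0]; split.
  apply: emeasurable_funM; first exact: measurable_mine.
  by apply: (proj1 (Mplus_indic _)); exact: measurable_itv.
by move=> t t0; rewrite mule_ge0// le_min f0//= lee_fin.
Qed.

Lemma truncate_nondecreasing f t : (0 <= f t) ->
  {homo truncate f ^~ t : m n / (m <= n)%N >-> m <= n}.
Proof.
move=> f0 m n mn; apply: lee_pmul.
- by rewrite le_min f0/= lee_fin.
- by rewrite lee_fin.
- by rewrite le_min !ge_min lexx/= lee_fin ler_nat mn orbT.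
rewrite lee_fin !indicE ler_nat; have [/set_mem|//] := boolP (t \in `]0%R, m%:R[%classic).
rewrite /= in_itv/= => /andP[t0 tm]; rewrite mem_set//= in_itv/= t0/=.
by rewrite (lt_le_trans tm)// ler_nat.
Qed.

Lemma le_lim_truncate f t : (0 < t)%R -> 0 <= f t ->
  f t <= limn (truncate f ^~ t).
Proof.
move=> t0 f0; have nd := truncate_nondecreasing f0.
rewrite (cvg_lim _ (ereal_nondecreasing_cvgn nd))//.
have key (r : R) : (0 <= r)%R -> r%:E <= f t ->
    r%:E <= ereal_sup (range (truncate f ^~ t)).
  move=> r0 rf; apply: le_ereal_sup_tmp.
  have tr0 : (0 <= t + r)%R by rewrite addr_ge0// ltW.
  (* n > t + r puts t inside ]0, n[ and leaves r below the cap n at once. *)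
  have := archi_boundP tr0; set n := Num.bound _ => trn.
  exists (truncate f n t); first by exists n.
  rewrite /truncate indicE mem_set ?mule1; last by rewrite /= in_itv/= t0; lra.
  by rewrite le_min rf lee_fin; lra.
case: (f t) f0 key => [r||]// f0 key; first exact: key.
rewrite leye_eq; apply/eqP/eqyP => r r0; apply: key; rewrite ?leey//; exact: ltW.
Qed.

(** Monotone convergence: a strict lower bound for the limit is already exceeded at a finite
    stage. *)
Lemma stieltjes_truncate f x (M : \bar R) : Mplus f -> (0 < x)%R ->
  M < stieltjes u f x -> exists n, M < stieltjes u (truncate f n) x.
Proof.
move=> Mf x0 MS.
have k0 t : D t -> 0 <= (kernel u x t)%:E.
  by rewrite /= in_itv/= andbT => t0; rewrite lee_fin ltW// kernel_gt0.
pose g n t := truncate f n t * (kernel u x t)%:E.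
have g0 n t : D t -> 0 <= g n t.
  move=> Dt; rewrite mule_ge0 ?k0// (proj2 (Mplus_truncate n Mf))//.
  by move: Dt; rewrite /= in_itv/= andbT.
have nd t : D t -> {homo g ^~ t : m n / (m <= n)%N >-> m <= n}.
  move=> Dt m n mn; rewrite lee_wpmul2r ?k0//; apply: truncate_nondecreasing mn.
  by apply: (proj2 Mf); move: Dt; rewrite /= in_itv/= andbT.
have mg n : measurable_fun D (g n).
  by apply: measurable_stieltjes => //; exact: Mplus_truncate.
have := @cvg_monotone_convergence _ _ _ mu _ (measurable_itv _) _ mg g0 nd.
set I := (X in _ --> X) => cvgI.
have SI : stieltjes u f x <= I.
  rewrite stieltjesE//; apply: ge0_le_integral => //.
  - move=> t Dt; rewrite mule_ge0 ?k0// (proj2 Mf)//.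
    by move: Dt; rewrite /= in_itv/= andbT.
  - exact: measurable_stieltjes.
  - apply: (emeasurable_fun_cvg g) => // t Dt.
    by apply: ereal_nondecreasing_is_cvgn; exact: nd.
  move=> t Dt; have t0 : (0 < t)%R by move: Dt; rewrite /= in_itv/= andbT.
  have ft := proj2 Mf _ t0; have nt := truncate_nondecreasing ft.
  apply: (@le_trans _ _ (limn (truncate f ^~ t) * (kernel u x t)%:E)).
    by rewrite lee_wpmul2r ?k0// le_lim_truncate.
  rewrite /g muleC -limeMl//; last exact: ereal_nondecreasing_is_cvgn.
  by rewrite (_ : (fun _ => _) = g ^~ t)//; apply/funext => n; rewrite muleC.
have ndI : {homo (fun n => \int[mu]_(t in D) g n t) : m n / (m <= n)%N >-> m <= n}.
  move=> m n mn; apply: ge0_le_integral => //; [exact: g0|exact: mg|exact: mg|].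
  by move=> t Dt; exact: (nd t Dt _ _ mn).
have := ereal_nondecreasing_cvgn ndI => /(cvg_unique _ cvgI) IE.
have : M < I by exact: lt_le_trans SI.
rewrite IE// => /ereal_sup_gt[_ [n _ <-] Mn].
by exists n; rewrite stieltjesE.
Qed.

(** Capping the height and cutting the support at n suffices: near 0 the kernel stays below 1 / U
    x. *)
Lemma stieltjes_truncate_lty f n x : Mplus f -> (0 < x)%R ->
  stieltjes u (truncate f n) x < +oo.
Proof.
move=> Mf x0; have Ux := primitive_gt0 aU x0.
have Mn := Mplus_truncate n Mf.
have mI : measurable (`]0%R, n%:R[%classic : set R) by exact: measurable_itv.
apply: (@le_lt_trans _ _ ((n%:R / U x)%:E * mu `]0%R, n%:R[%classic)); last first.
  rewrite lte_mul_pinfty ?lee_fin ?divr_ge0 ?(ltW Ux)//.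
  by rewrite lebesgue_measure_itv/=; case: ifP => // _; rewrite -EFinB ltry.
have -> : mu `]0%R, n%:R[%classic = \int[mu]_(s in D) (\1_(`]0%R, n%:R[%classic : set R) s)%:E.
  rewrite (integral_indic mu (measurable_itv _) mI); congr (mu _).
  apply/esym/setIidl => t /=; rewrite !in_itv/= andbT; by case/andP.
rewrite stieltjesE// -ge0_integralZl_EFin ?divr_ge0 ?(ltW Ux)//; last first.
  exact: (proj1 (Mplus_indic mI)).
apply: ge0_le_integral => //.
- move=> s /=; rewrite in_itv/= andbT => s0.
  by rewrite mule_ge0 ?(proj2 Mn)// lee_fin ltW// kernel_gt0.
- exact: measurable_stieltjes.
- by apply: emeasurable_funM => //; exact: (proj1 (Mplus_indic mI)).
move=> s /=; rewrite in_itv/= andbT => s0; have Us := primitive_gt0 aU s0.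
rewrite /truncate muleAC lee_wpmul2r ?lee_fin// EFinM; apply: lee_pmul.
- by rewrite le_min (proj2 Mf)//= lee_fin.
- by rewrite lee_fin ltW// kernel_gt0.
- by rewrite ge_min lexx orbT.
- rewrite lee_fin /kernel lef_pV2 ?posrE ?addr_gt0//.
  by rewrite lerDl ltW.
Qed.

(* The equality case of Hoelder's inequality, f ^ (p - 1) * v = k_x; it is +oo
   where [v] vanishes and need not have finite norm, hence the truncations. *)
Definition extremal (q : R) v x t : \bar R :=
  (kernel u x t `^ (q - 1))%:E * ((v t `^ (q - 1))%:E)^-1.

(** The extremal times k_x is k_x^q * v^(1-q), so its transform at x is the q-th power of the dual
    norm of k_x. *)
Definition dual_normp (q : R) v x : \bar R := stieltjes u (extremal q v x) x `^ q^-1.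

Lemma Mplus_extremal q v x : weight v -> (0 < x)%R -> Mplus (extremal q v x).
Proof.
move=> [[mv _ _] v0] x0; split; last first.
  by move=> t t0; rewrite mule_ge0 ?inve_ge0// lee_fin powR_ge0.
apply: emeasurable_funM.
  apply/measurable_EFinP.
  by apply: (measurableT_comp (measurable_powR _)); exact: measurable_kernel.
apply: measurable_inve_EFin => [|t _]; last exact: powR_ge0.
exact: (measurableT_comp (measurable_powR _)).
Qed.

Section Exponents.
Context (p q : R).
Context (p1 : (1 < p)%R) (pq : (p^-1 + q^-1 = 1)%R).

Lemma conj_gt0 : (0 < p)%R.
Proof. exact: lt_trans ltr01 p1. Qed.

Lemma conj_gt1 : (1 < q)%R.
Proof.
have p0 := conj_gt0.
have q1 : (q^-1 < 1)%R by rewrite -pq ltrDr invr_gt0.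
have q0 : (0 < q^-1)%R.
  have -> : (q^-1 = 1 - p^-1)%R by rewrite -pq addrC addKr.
  by rewrite subr_gt0 invf_lt1.
by rewrite invr_gt0 in q0; rewrite invf_lt1 in q1.
Qed.

Lemma conj_mul : (p * q = p + q)%R.
Proof.
have p0 := conj_gt0; have q0 := lt_trans ltr01 conj_gt1.
rewrite -[LHS]mulr1 -pq; field.
by rewrite !gt_eqF.
Qed.

Lemma dual_normpE v x : weight v -> (0 < x)%R ->
  epow (\int[mu]_(t in D) (epow (calU U t x)%:E q * epow (U t)%:E (- q) *
          epow (v t)%:E (1 - q))) q^-1 = dual_normp q v x.
Proof.
move=> wv x0; have q1 := conj_gt1; have q0 := lt_trans ltr01 q1.
rewrite /dual_normp [LHS]/epow ltNge invr_ge0 ltW//=; congr (_ `^ _).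
rewrite stieltjesE//; apply: eq_integral => t; rewrite inE/= in_itv/= andbT => t0.
have Ut := primitive_gt0 aU t0; have kt := kernel_gt0 aU x0 t0.
rewrite /epow ltNge ltW//= oppr_lt0 q0 subr_lt0 q1 opprK opprB ?poweR_EFin.
rewrite (_ : calU U t x = U t * kernel u x t)%R//.
rewrite powRM ?(ltW Ut) ?(ltW kt)// [X in _ * X * _]inver gt_eqF ?powR_gt0//.
rewrite -EFinM mulrAC divff ?mul1r; last by rewrite gt_eqF// powR_gt0.
by rewrite /extremal [RHS]muleAC -EFinM [in RHS]mulrC mulr_powRB1// ltW.
Qed.

(* Young's inequality, with a free parameter to be optimised after
   integration; the second term is [+oo] where [v] vanishes. *)
Lemma kernel_young v h x t (l : R) : weight v -> Mplus h -> (0 < x)%R ->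
  (0 < t)%R -> (0 < l)%R ->
  h t * (kernel u x t)%:E <= (l `^ p)%:E * (`|h t| `^ p * (v t)%:E) +
    (l `^ (- q))%:E * (extremal q v x t * (kernel u x t)%:E).
Proof.
move=> wv Mh x0 t0 l0; have p0 := conj_gt0; have q1 := conj_gt1.
have q0 := lt_trans ltr01 q1; have kt := kernel_gt0 aU x0 t0.
have ht := proj2 Mh _ t0; have vt := proj2 wv _ t0.
have lp : (0 < l `^ p)%R by exact: powR_gt0.
have lq : (0 < l `^ (- q))%R by exact: powR_gt0.
have kq : (0 < kernel u x t `^ (q - 1))%R by exact: powR_gt0.
rewrite gee0_abs//.
have A0 : 0 <= (l `^ p)%:E * (h t `^ p * (v t)%:E).
  by rewrite !mule_ge0 ?poweR_ge0 ?lee_fin ?(ltW lp).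
have B0 : 0 <= (l `^ (- q))%:E * (extremal q v x t * (kernel u x t)%:E).
  have e0 := proj2 (Mplus_extremal q wv x0) _ t0.
  by apply: mule_ge0; [rewrite lee_fin ltW|rewrite mule_ge0// lee_fin ltW].
have [v0|vn0] := eqVneq (v t) 0%R.
  have -> : (l `^ (- q))%:E * (extremal q v x t * (kernel u x t)%:E) = +oo.
    rewrite /extremal v0 powR0 ?subr_eq0 ?gt_eqF// inve0.
    by rewrite gt0_muley ?lte_fin// gt0_mulye ?lte_fin// gt0_muley.
  by rewrite addey ?leey// -ltNye (lt_le_trans _ A0).
have {vn0 vt}vt : (0 < v t)%R by rewrite lt_neqAle eq_sym vn0.
case: (h t) ht A0 => [r||]// ht A0; last first.
  have -> : (l `^ p)%:E * (+oo `^ p * (v t)%:E) = +oo.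
    by rewrite poweRyr ?gt_eqF// gt0_mulye ?lte_fin// gt0_muley ?lte_fin.
  by rewrite addye ?leey// -ltNye (lt_le_trans _ B0).
rewrite lee_fin in ht; rewrite /extremal inver gt_eqF ?powR_gt0//.
rewrite ?poweR_EFin -!EFinM -EFinD lee_fin.
(* Young is applied to l * h * y and k_x / (l * y), where y^p = v and y^q = v^(q-1). Its
   coefficients 1/p and 1/q are then bounded by 1, whence the factor 2 after optimisation. *)
pose y := (v t `^ p^-1)%R; have y0 : (0 < y)%R by exact: powR_gt0.
have -> : (r * kernel u x t = (l * r * y) * (kernel u x t / (l * y)))%R.
  by field; rewrite !gt_eqF.
apply: le_trans (conjugate_powR _ _ p0 q0 pq) _.
- by rewrite !mulr_ge0// ltW.
- by rewrite divr_ge0 ?mulr_ge0// ltW.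
have yp : (y `^ p = v t)%R by rewrite /y -powRrM mulVf ?gt_eqF// powRr1// ltW.
have yq : (y `^ q = v t `^ (q - 1))%R.
  rewrite /y -powRrM; congr (_ `^ _)%R; apply: (mulfI (lt0r_neq0 p0)).
  by rewrite mulrA divff ?gt_eqF// mul1r mulrBr conj_mul mulr1 addrC addKr.
rewrite lerD//.
  apply: (@le_trans _ _ ((l * r * y) `^ p)%R).
    by rewrite ler_pdivrMr// ler_peMr ?powR_ge0// ltW.
  by rewrite !powRM ?mulr_ge0 ?(ltW l0) ?(ltW y0)// yp mulrA.
apply: (@le_trans _ _ ((kernel u x t / (l * y)) `^ q)%R).
  by rewrite ler_pdivrMr// ler_peMr ?powR_ge0// ltW.
have ly0 : (0 < l * y)%R by rewrite mulr_gt0.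
rewrite (powRM _ (ltW kt)) ?invr_ge0 ?(ltW ly0)//.
rewrite -(powR_inv1 (ltW ly0)) -powRrM mulN1r !powRN powRM ?(ltW l0) ?(ltW y0)// yq.
rewrite -(mulr_powRB1 (ltW kt) q0) invfM.
by rewrite le_eqVlt; apply/orP; left; apply/eqP; ring.
Qed.

(** For a, b > 0 the choice l = (a b)^(1/p) / a makes both terms equal to a b. *)
Lemma optimise_young (s a b : R) : (0 <= a)%R -> (0 <= b)%R ->
  (forall l : R, (0 < l)%R -> s <= (l * a) `^ p + (b / l) `^ q)%R ->
  (s <= 2 * (a * b))%R.
Proof.
move=> a0 b0 H; have p0 := conj_gt0; have q0 := lt_trans ltr01 conj_gt1.
have [a_eq0|an0] := eqVneq a 0%R.
  rewrite a_eq0 mul0r mulr0 leNgt; apply/negP => s0.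
  pose z := (s `^ q^-1)%R; have z0 : (0 < z)%R by exact: powR_gt0.
  (* This l gives b / l < z, hence (b / l)^q < s; adding 1 keeps l positive if b = 0. *)
  have l0 : (0 < (b + 1) / z)%R by rewrite divr_gt0// ltr_wpDl.
  have := H _ l0; rewrite a_eq0 mulr0 powR0 ?gt_eqF// add0r leNgt => /negP; apply.
  have -> : (s = z `^ q)%R by rewrite /z -powRrM mulVf ?gt_eqF// powRr1// ltW.
  have zb : (0 <= b / ((b + 1) / z))%R by rewrite divr_ge0// ltW.
  apply: gt0_ltr_powR; rewrite ?nnegrE ?(ltW z0)//.
  rewrite ltr_pdivrMr// mulrC divfK ?gt_eqF//; lra.
have [b_eq0|bn0] := eqVneq b 0%R.
  rewrite b_eq0 !mulr0 leNgt; apply/negP => s0.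
  pose z := (s `^ p^-1)%R; have z0 : (0 < z)%R by exact: powR_gt0.
  have l0 : (0 < z / (a + 1))%R by rewrite divr_gt0// ltr_wpDl.
  have := H _ l0; rewrite b_eq0 mul0r [X in (_ + X)%R]powR0 ?gt_eqF// addr0.
  rewrite leNgt => /negP; apply.
  have -> : (s = z `^ p)%R by rewrite /z -powRrM mulVf ?gt_eqF// powRr1// ltW.
  have za : (0 <= z / (a + 1) * a)%R by rewrite mulr_ge0// ltW.
  apply: gt0_ltr_powR; rewrite ?nnegrE ?(ltW z0)//.
  rewrite mulrAC ltr_pdivrMr ?ltr_wpDl//; rewrite ltr_pM2l//; lra.
have {an0 a0}a0 : (0 < a)%R by rewrite lt_neqAle eq_sym an0.
have {bn0 b0}b0 : (0 < b)%R by rewrite lt_neqAle eq_sym bn0.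
have c0 : (0 < a * b)%R by rewrite mulr_gt0.
pose z := ((a * b) `^ p^-1)%R; have z0 : (0 < z)%R by exact: powR_gt0.
have := H (z / a)%R (divr_gt0 z0 a0).
have -> : (z / a * a = z)%R by rewrite divfK// gt_eqF.
have -> : (b / (z / a) = (a * b) `^ q^-1)%R.
  have -> : (b / (z / a) = (a * b) / z)%R by field; rewrite !gt_eqF.
  rewrite -[X in (X / _)%R]powRr1 ?(ltW c0)// -pq powRD ?pq ?oner_eq0//.
  by rewrite mulrAC divff ?mul1r// gt_eqF.
rewrite /z -!powRrM !mulVf ?gt_eqF// powRr1 ?(ltW c0)//; lra.
Qed.

Lemma optimise_young_powR (s a b : R) : (0 <= a)%R -> (0 <= b)%R ->
  (forall l : R, (0 < l)%R -> s <= l `^ p * a + l `^ (- q) * b)%R ->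
  (s <= 2 * (a `^ p^-1 * b `^ q^-1))%R.
Proof.
move=> a0 b0 H; have p0 := conj_gt0; have q0 := lt_trans ltr01 conj_gt1.
apply: optimise_young; rewrite ?powR_ge0// => l l0.
have li0 : (0 <= l^-1)%R by rewrite invr_ge0 ltW.
have lV : (l^-1 `^ q = l `^ (- q))%R.
  by rewrite -(powR_inv1 (ltW l0)) -powRrM mulN1r.
rewrite (powRM _ (ltW l0) (powR_ge0 _ _)) (powRM _ (powR_ge0 _ _) li0) lV.
rewrite -!powRrM !mulVf ?gt_eqF// !powRr1// [X in (_ <= _ + X)%R]mulrC.
exact: H.
Qed.

Lemma dual_normp_ub v x h : weight v -> (0 < x)%R -> Mplus h ->
  dual_normp q v x < +oo -> wnorm p%:E v h < +oo ->
  stieltjes u h x <= 2%:E * (dual_normp q v x * wnorm p%:E v h).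
Proof.
move=> wv x0 Mh; have p0 := conj_gt0; have q1 := conj_gt1.
have q0 := lt_trans ltr01 q1; have Me := Mplus_extremal q wv x0.
rewrite /dual_normp /wnorm; set G := stieltjes u _ x.
set A := \int[mu]_(y in _) _.
have hv0 t : D t -> 0 <= `|h t| `^ p * (v t)%:E.
  rewrite /= in_itv/= andbT => t0.
  by rewrite mule_ge0 ?poweR_ge0// lee_fin (proj2 wv).
have mhv : measurable_fun D (fun t => `|h t| `^ p * (v t)%:E).
  apply: emeasurable_funM; last by apply/measurable_EFinP; case: wv => -[].
  apply: (measurableT_comp (measurable_poweR _)).
  by apply: measurableT_comp => //; case: Mh.
have ek0 t : D t -> 0 <= extremal q v x t * (kernel u x t)%:E.
  rewrite /= in_itv/= andbT => t0; rewrite mule_ge0 ?(proj2 Me)//.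
  by rewrite lee_fin ltW// kernel_gt0.
have mek := measurable_stieltjes aU Me x0.
have A0 : 0 <= A by exact: integral_ge0.
have G0 : 0 <= G by exact: stieltjes_ge0.
move=> /lty_poweRy => /(_ (invr_neq0 (lt0r_neq0 q0))) Gy.
move=> /lty_poweRy => /(_ (invr_neq0 (lt0r_neq0 p0))) Ay.
have young (l : R) : (0 < l)%R ->
    stieltjes u h x <= (l `^ p)%:E * A + (l `^ (- q))%:E * G.
  move=> l0; have lp : (0 <= l `^ p)%R by exact: powR_ge0.
  have lq : (0 <= l `^ (- q))%R by exact: powR_ge0.
  rewrite /G /A !stieltjesE// -!ge0_integralZl_EFin// -ge0_integralD//.
  - apply: ge0_le_integral => //.
    + move=> t /=; rewrite in_itv/= andbT => t0.
      by rewrite mule_ge0 ?(proj2 Mh)// lee_fin ltW// kernel_gt0.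
    + exact: measurable_stieltjes.
    + by apply: emeasurable_funD; exact: emeasurable_funM.
    + by move=> t /=; rewrite in_itv/= andbT => t0; exact: kernel_young.
  - by move=> t Dt; rewrite mule_ge0 ?hv0.
  - exact: emeasurable_funM.
  - by move=> t Dt; apply: mule_ge0 => //; exact: ek0.
  - exact: emeasurable_funM.
have Af : A \is a fin_num by rewrite ge0_fin_numE.
have Gf : G \is a fin_num by rewrite ge0_fin_numE.
have S0 := stieltjes_ge0 aU Mh x0.
(* Any l, here 1, shows finiteness, after which the optimisation takes place in the reals. *)
have Sf : stieltjes u h x \is a fin_num.
  rewrite ge0_fin_numE// (le_lt_trans (young 1%R ltr01))//.
  by rewrite -(fineK Af) -(fineK Gf) -!EFinM -EFinD ltry.
rewrite -(fineK Sf) -(fineK Af) -(fineK Gf) !poweR_EFin -!EFinM lee_fin.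
rewrite [X in (_ * X)%R]mulrC; apply: optimise_young_powR => [||l l0].
- exact: fine_ge0.
- exact: fine_ge0.
by have := young l l0; rewrite -{1}(fineK Sf) -(fineK Af) -(fineK Gf) -!EFinM -EFinD lee_fin.
Qed.

(** The equality case h^p * v = h * k_x survives truncation as an inequality: h <= (k_x / v)^(q-1)
    gives h^(p-1) <= k_x / v, since (p-1)(q-1) = 1. *)
Lemma truncate_extremal_norm v x n : weight v -> (0 < x)%R ->
  wnorm p%:E v (truncate (extremal q v x) n) <=
  stieltjes u (truncate (extremal q v x) n) x `^ p^-1.
Proof.
move=> wv x0; have p0 := conj_gt0; have q1 := conj_gt1.
have q0 := lt_trans ltr01 q1; have Me := Mplus_extremal q wv x0.
set h := truncate _ _; have Mh : Mplus h by exact: Mplus_truncate.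
have hv0 t : D t -> 0 <= `|h t| `^ p * (v t)%:E.
  rewrite /= in_itv/= andbT => t0.
  by rewrite mule_ge0 ?poweR_ge0// lee_fin (proj2 wv).
apply: gt0_ler_poweR.
- by rewrite invr_ge0 ltW.
- by rewrite in_itv/= leey andbT; exact: integral_ge0.
- by rewrite in_itv/= leey andbT stieltjes_ge0.
rewrite stieltjesE//; apply: ge0_le_integral => //.
- apply: emeasurable_funM; last by apply/measurable_EFinP; case: wv => -[].
  apply: (measurableT_comp (measurable_poweR _)).
  by apply: measurableT_comp => //; case: Mh.
- exact: measurable_stieltjes.
move=> t /=; rewrite in_itv/= andbT => t0.
have ht := proj2 Mh _ t0; rewrite gee0_abs//.
have kt := kernel_gt0 aU x0 t0; have vt := proj2 wv _ t0.
have et := proj2 Me _ t0.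
have he : h t <= extremal q v x t.
  rewrite /h /truncate indicE; case: (_ \in _); rewrite ?mule1 ?mule0//.
  by rewrite ge_min lexx.
have hn : h t <= n%:R%:E.
  rewrite /h /truncate indicE; case: (_ \in _); rewrite ?mule1 ?mule0 ?lee_fin//.
  by rewrite ge_min lexx orbT.
case: (h t) ht he hn => [r||]// ; rewrite lee_fin => r0 he _.
rewrite poweR_EFin -!EFinM lee_fin.
move: r0; rewrite le_eqVlt => /predU1P[<-|r0].
  by rewrite powR0 ?gt_eqF// !mul0r.
rewrite -(mulr_powRB1 (ltW r0) p0) -mulrA ler_pM2l//.
move: vt; rewrite le_eqVlt => /predU1P[<-|vt]; first by rewrite mulr0 ltW.
rewrite -ler_pdivlMr//.
have kv : (0 < kernel u x t / v t)%R by rewrite divr_gt0.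
have kvE : ((kernel u x t / v t) `^ (q - 1) = kernel u x t `^ (q - 1) / v t `^ (q - 1))%R.
  rewrite (powRM _ (ltW kt)) ?invr_ge0 ?(ltW vt)//.
  by rewrite -(powR_inv1 (ltW vt)) -powRrM mulN1r powRN.
move: he; rewrite /extremal inver gt_eqF ?powR_gt0// -EFinM lee_fin -kvE => he.
have -> : (kernel u x t / v t = ((kernel u x t / v t) `^ (q - 1)) `^ (p - 1))%R.
  rewrite -powRrM (_ : ((q - 1) * (p - 1) = 1)%R) ?powRr1 ?(ltW kv)//.
  by have := conj_mul; lra.
apply: ge0_ler_powR => //; rewrite ?nnegrE ?powR_ge0 ?(ltW r0)//.
by rewrite subr_ge0 ltW.
Qed.

(** If J is the transform at x of a late truncation h, then M^q < J < +oo and the norm of h is at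
    most J^(1/p), so M times the norm is at most J^(1/q + 1/p) = J. *)
Lemma dual_normp_lb v x (M : R) : weight v -> (0 < x)%R -> (0 < M)%R ->
  M%:E < dual_normp q v x ->
  exists h, [/\ Mplus h, wnorm p%:E v h < +oo, 0 < stieltjes u h x &
    M%:E * wnorm p%:E v h <= stieltjes u h x].
Proof.
move=> wv x0 M0 MB; have p0 := conj_gt0; have q1 := conj_gt1.
have q0 := lt_trans ltr01 q1; have Me := Mplus_extremal q wv x0.
have Mq : (M `^ q)%:E < stieltjes u (extremal q v x) x.
  rewrite ltNge; apply/negP => GM; move: MB; rewrite ltNge => /negP; apply.
  have -> : M = ((M `^ q) `^ q^-1)%R by rewrite -powRrM divff ?gt_eqF// powRr1// ltW.
  rewrite -poweR_EFin; apply: gt0_ler_poweR => //.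
  - by rewrite invr_ge0 ltW.
  - by rewrite in_itv/= leey andbT stieltjes_ge0.
  - by rewrite in_itv/= leey andbT lee_fin powR_ge0.
have [n Mn] := stieltjes_truncate Me x0 Mq.
exists (truncate (extremal q v x) n).
have nle := truncate_extremal_norm n wv x0.
have Jy := stieltjes_truncate_lty n Me x0.
have J0 : 0 < stieltjes u (truncate (extremal q v x) n) x.
  by apply: lt_trans Mn; rewrite lte_fin powR_gt0.
split => //; first exact: Mplus_truncate.
  by apply: le_lt_trans nle _; exact: poweR_lty.
apply: (@le_trans _ _ (M%:E *
    stieltjes u (truncate (extremal q v x) n) x `^ p^-1)).
  by rewrite lee_wpmul2l// lee_fin ltW.
move: (stieltjes _ _ _) Jy J0 Mn => [r||]// _; rewrite !lte_fin => r0 Mr.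
rewrite poweR_EFin -EFinM lee_fin.
have Mr' : (M <= r `^ q^-1)%R.
  have -> : M = ((M `^ q) `^ q^-1)%R by rewrite -powRrM divff ?gt_eqF// powRr1// ltW.
  by apply: ge0_ler_powR; rewrite ?nnegrE ?powR_ge0 ?invr_ge0 ?(ltW q0) ?(ltW r0) ?(ltW Mr).
apply: (@le_trans _ _ (r `^ q^-1 * r `^ p^-1)%R).
  by rewrite ler_wpM2r ?powR_ge0.
rewrite -powRD; first by rewrite addrC pq powRr1// ltW.
by rewrite addrC pq oner_eq0.
Qed.

End Exponents.

End WeightedDualNorm.

Theorem theorem5p7 (R : realType) :
  [/\ (* p = 1 *)
      exists2 lambda : R, (0 < lambda)%R &
        forall u v w : R -> R, standing_assumptions u v w ->
          ((exists2 c : R, (0 <= c)%R & stieltjes_ineq u v w 1%:E c) <->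
             S6 u v w < +oo) /\
          equiv_upto lambda (best_constant u v w 1%:E) (S6 u v w),
      (* 1 < p < oo *)
      forall p q : R, (1 < p)%R -> (p^-1 + q^-1 = 1)%R ->
      exists2 lambda : R, (0 < lambda)%R &
        forall u v w : R -> R, standing_assumptions u v w ->
          ((exists2 c : R, (0 <= c)%R & stieltjes_ineq u v w p%:E c) <->
             S7 u v w q < +oo) /\
          equiv_upto lambda (best_constant u v w p%:E) (S7 u v w q) &
      (* p = oo *)
      exists2 lambda : R, (0 < lambda)%R &
        forall u v w : R -> R, standing_assumptions u v w ->
          ((exists2 c : R, (0 <= c)%R & stieltjes_ineq u v w +oo c) <->
             S8 u v w < +oo) /\
          equiv_upto lambda (best_constant u v w +oo) (S8 u v w)].
Proof.
(* Pads the bounds proved with constant 1 (both for p = oo, the lower one for 1 < p < oo) to the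
   common factor 2. *)
have le2 (a b : \bar R) : 0 <= b -> a <= b -> a <= 2%:E * b.
  move=> b0 ab; apply: le_trans ab _; rewrite -[leLHS]mul1e lee_wpmul2r//.
  by rewrite lee_fin; lra.
have gt0 (x : R) : [set` `]0%R, +oo[] x -> (0 < x)%R by rewrite /= in_itv/= andbT.
split=> [|p q p1 pq|]; exists 6%R => // u v w [_ wv ww aU _].
- have -> : S6 u v w =
      ereal_sup [set sup_w_calU u w x * dual_norm1 u v x | x in `]0%R, +oo[].
    by congr ereal_sup; apply: eq_imagel => x _; rewrite /dual_norm1 muleA.
  apply: stieltjes_ineq_dual => //.
  + by move=> x x0; exact: dual_norm1_ge0.
  + by move=> x h x0 Mh By _; exact: dual_norm1_ub.
  + by move=> x M x0 M0 MB; exact: dual_norm1_lb.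
- have -> : S7 u v w q =
      ereal_sup [set sup_w_calU u w x * dual_normp u q v x | x in `]0%R, +oo[].
    congr ereal_sup; apply: eq_imagel => x /gt0 x0; congr (_ * _).
    exact: (dual_normpE aU p1 pq).
  apply: stieltjes_ineq_dual => //.
  + by move=> x x0; exact: poweR_ge0.
  + by move=> x h x0 Mh By hy; apply: dual_normp_ub.
  + move=> x M x0 M0 MB.
    have [h [Mh hy S0 MS]] := dual_normp_lb aU p1 pq wv x0 M0 MB.
    by exists h; split => //; apply: le2 => //; exact: ltW.
- have -> : S8 u v w =
      ereal_sup [set sup_w_calU u w x * dual_normy u v x | x in `]0%R, +oo[].
    by congr ereal_sup; apply: eq_imagel => x /gt0 x0; rewrite dual_normyE.
  have dual_ge0 x : (0 < x)%R -> 0 <= dual_normy u v x.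
    move=> x0; apply: integral_ge0 => t /gt0 t0; rewrite mule_ge0 ?inve_ge0 ?lee_fin//.
      by rewrite ltW// kernel_gt0.
    exact: (proj2 wv).
  apply: stieltjes_ineq_dual => //.
  + move=> x h x0 Mh By hy; apply: le2; last exact: dual_normy_ub.
    by rewrite mule_ge0 ?dual_ge0 ?wnorm_ge0.
  + move=> x M x0 M0 MB.
    have [h [Mh hy S0 MS]] := dual_normy_lb aU wv x0 M0 MB.
    by exists h; split => //; apply: le2 => //; exact: ltW.
Qed.
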